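(* If $P$ is a uniformly Lubell-bounded poset, then $RR(P,Q)=e(P)(|Q|-1)$ holds for any poset $Q$.
   Context: All posets are finite and non-empty. $B_n$ is the Boolean lattice of all subsets of $[n]=\{1,\dots,n\}$ ordered by inclusion ($n\ge 0$); a level of $B_n$ is the collection of all sets of a given size. A subset $X$ of a poset $R$ is a weak copy of a poset $P$ if there is a bijection $\alpha:P\to X$ such that $p\le_P p'$ implies $\alpha(p)\le_R\alpha(p')$. A copy is monochromatic with respect to a coloring if all its elements have the same color, and rainbow if its elements have pairwise distinct colors. The weak rainbow Ramsey number $RR(P,Q)$ is the minimum $n$ such that any coloring of $B_n$ (with colors from $\mathbb{N}$, any number of colors) admits either a monochromatic weak copy of $P$ or a rainbow weak copy of $Q$. A family $\mathcal{F}\subseteq B_n$ is $P$-free if it contains no weak copy of $P$. $e(P)$ is the maximum number $m$ such that for every $n$ the union of any $m$ consecutive levels of $B_n$ is $P$-free. The Lubell-mass of $\mathcal{F}\subseteq B_n$ is $\lambda_n(\mathcal{F})=\sum_{F\in\mathcal{F}}\binom{n}{|F|}^{-1}$, and $\lambda_n(P)$ is the maximum of $\lambda_n(\mathcal{F})$ over all $P$-free families $\mathcal{F}\subseteq B_n$. $P$ is uniformly Lubell-bounded if $e(P)\ge\lambda_n(P)$ for all positive integers $n$. *)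

(* Defs.v *)
From mathcomp Require Import boolp classical_sets.
From mathcomp Require Import all_boot all_order all_algebra.

Set Implicit Arguments.
Unset Strict Implicit.
Unset Printing Implicit Defensive.

Import Order.TTheory GRing.Theory Num.Theory.

(* Orders {set T} by inclusion: [A <= B]%O unfolds to [A \subset B]. *)
Import Order.DefaultSetSubsetOrder.

(* Minimum and maximum of a set of naturals, with junk value 0 when they do
   not exist; [e_max] and [RR_min] below show that the junk value is never
   used for nonempty posets. *)
Definition is_max (S : nat -> Prop) (m : nat) : Prop :=
  S m /\ forall k : nat, S k -> k <= m.

Definition is_min (S : nat -> Prop) (m : nat) : Prop :=
  S m /\ forall k : nat, S k -> m <= k.

Definition nat_max (S : nat -> Prop) : nat := xget 0 (is_max S).

Definition nat_min (S : nat -> Prop) : nat := xget 0 (is_min S).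

Definition B (n : nat) := {set 'I_n}.

Section Copies.

Variables (dP dR : Order.disp_t) (P : finPOrderType dP) (R : finPOrderType dR).

Definition weak_copy (X : {set R}) : Prop :=
  exists alpha : P -> R,
    [/\ injective alpha,
        alpha @: [set: P] = X &
        forall p p' : P, (p <= p')%O -> (alpha p <= alpha p')%O].

Definition free (F : {set R}) : Prop :=
  ~ exists2 X : {set R}, X \subset F & weak_copy X.

Definition monochromatic (c : R -> nat) (X : {set R}) : Prop :=
  forall x y : R, x \in X -> y \in X -> c x = c y.

Definition rainbow (c : R -> nat) (X : {set R}) : Prop :=
  forall x y : R, x \in X -> y \in X -> c x = c y -> x = y.

End Copies.

Arguments weak_copy {dP dR} P {R} X.
Arguments free {dP dR} P {R} F.

Definition level (n k : nat) : {set B n} := [set F : B n | #|F| == k]%SET.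

Definition levels (n i m : nat) : {set B n} :=
  (\bigcup_(i <= j < i + m) level n j)%SET.

(* [i + m <= n.+1] says that the [m] levels i, ..., i + m - 1 all exist. *)
Definition levels_free (d : Order.disp_t) (P : finPOrderType d) (m : nat) :
    Prop :=
  forall n i : nat, i + m <= n.+1 -> free P (levels n i m).

Definition e (d : Order.disp_t) (P : finPOrderType d) : nat :=
  nat_max (levels_free P).

Definition lubell_mass (n : nat) (F : {set B n}) : rat :=
  (\sum_(A in F) ('C(n, #|A|)%:R)^-1)%R.

(* The default 0 is harmless: it is the mass of the empty family, which is
   free of every nonempty poset. *)
Definition lambda (n : nat) (d : Order.disp_t) (P : finPOrderType d) : rat :=
  \big[Order.max/0%R]_(F : {set B n} | `[< free P F >]) lubell_mass F.

Definition uniformly_Lubell_bounded (d : Order.disp_t) (P : finPOrderType d) :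
    Prop :=
  forall n : nat, 0 < n -> (lambda n P <= (e P)%:R)%R.

Definition rainbow_ramsey (dP dQ : Order.disp_t) (P : finPOrderType dP)
    (Q : finPOrderType dQ) (n : nat) : Prop :=
  forall c : B n -> nat,
    (exists2 X : {set B n}, weak_copy P X & monochromatic c X) \/
    (exists2 X : {set B n}, weak_copy Q X & rainbow c X).

Definition RR (dP dQ : Order.disp_t) (P : finPOrderType dP)
    (Q : finPOrderType dQ) : nat :=
  nat_min (rainbow_ramsey P Q).

Lemma nat_maxP (S : nat -> Prop) (b : nat) :
  (exists k, S k) -> (forall k, S k -> k <= b) -> is_max S (nat_max S).
Proof.
move=> exS leS; apply: xgetPex.
have exS' : exists k, `[< S k >] by case: exS => k Sk; exists k; apply/asboolP.
have leS' k : `[< S k >] -> k <= b by move/asboolP/leS.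
case: (ex_maxnP exS' leS') => m /asboolP Sm mP.
by exists m; split=> // k Sk; apply/mP/asboolP.
Qed.

Lemma nat_minP (S : nat -> Prop) :
  (exists k, S k) -> is_min S (nat_min S).
Proof.
move=> exS; apply: xgetPex.
have exS' : exists k, `[< S k >] by case: exS => k Sk; exists k; apply/asboolP.
case: (ex_minnP exS') => m /asboolP Sm mP.
by exists m; split=> // k Sk; apply/mP/asboolP.
Qed.

Section Key.

Variables (d : Order.disp_t) (P : finPOrderType d).

(* An injective monotone map from P to the naturals. *)
Definition key (p : P) : nat :=
  #|[set q : P | (q < p)%O]%SET| * #|P| + enum_rank p.

Lemma key_bound p : key p < #|P| * #|P|.
Proof.
have h : #|[set q : P | (q < p)%O]%SET| < #|P|.
  rewrite -cardsT; apply/proper_card/properP; split; first exact: subsetT.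
  by exists p; rewrite !inE ?ltxx.
apply: (@leq_trans (#|[set q : P | (q < p)%O]%SET|.+1 * #|P|)).
  by rewrite mulSn addnC /key -addnS leq_add2l.
by rewrite leq_mul2r h orbT.
Qed.

Lemma key_inj : injective key.
Proof.
move=> p q /(congr1 (modn^~ #|P|)); rewrite /key !modnMDl !modn_small //.
by move/val_inj/enum_rank_inj.
Qed.

Lemma key_homo p q : (p <= q)%O -> key p <= key q.
Proof.
rewrite le_eqVlt => /predU1P[-> //|pq].
apply: (@leq_trans (#|[set r : P | (r < p)%O]%SET|.+1 * #|P|)).
  by rewrite mulSn addnC /key leq_add2l ltnW.
apply: leq_trans (leq_addr _ _); rewrite leq_mul2r; apply/orP; right.
apply/proper_card/properP; split.
  by apply/subsetP=> r; rewrite !inE => /lt_trans; apply.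
by exists p; rewrite !inE ?ltxx.
Qed.

Lemma chain_copy (n : nat) (K : seq nat) :
  uniq K -> {in K, forall k, k <= n} -> #|P| * #|P| <= size K ->
  exists2 X : {set B n}, weak_copy P X &
    forall A, A \in X ->
      #|A| \in K /\ A = [set i : 'I_n | i < #|A|]%SET.
Proof.
move=> uK leK szK.
pose s := sort leq K.
pose ch k : B n := [set i : 'I_n | i < k]%SET.
have chK k : k <= n -> #|ch k| = k.
  move=> kn; have -> : ch k = [set widen_ord kn i | i in 'I_k]%SET.
    apply/setP=> i; rewrite inE; apply/idP/imsetP => [ik|[j _ ->] //=].
    by exists (Ordinal ik) => //; apply: val_inj.
  rewrite card_imset ?card_ord // => i j /(congr1 val) /=.
  exact: val_inj.
have us : uniq s by rewrite sort_uniq.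
have szs p : key p < size s.
  by rewrite size_sort; apply: leq_trans szK; apply: key_bound.
have sK p : nth 0 s (key p) \in K by rewrite -(mem_sort leq) mem_nth.
pose al p := ch (nth 0 s (key p)).
have cal p : #|al p| = nth 0 s (key p) by apply/chK/leK/sK.
exists (al @: [set: P])%SET; last first.
  by move=> _ /imsetP[p _ ->]; rewrite {3}/al cal; split.
exists al; split=> // [p q epq|p q pq].
  have /eqP : nth 0 s (key p) = nth 0 s (key q) by rewrite -!cal epq.
  by rewrite nth_uniq // => /eqP/key_inj.
have le_pq : nth 0 s (key p) <= nth 0 s (key q).
  apply: (sorted_leq_nth leq_trans leqnn); rewrite ?inE //.
    exact: (sort_sorted leq_total).
  exact: key_homo.
rewrite -[(_ <= _)%O]/(al p \subset al q).
by apply/subsetP=> i; rewrite !inE => /leq_trans; apply.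
Qed.

End Key.

Lemma e_max (d : Order.disp_t) (P : finPOrderType d) :
  0 < #|P| -> is_max (levels_free P) (e P).
Proof.
move=> P0; apply: (@nat_maxP _ (#|P| * #|P|)).
  exists 0 => n i _ [X]; rewrite /levels addn0 big_geq // subset0 => /eqP->.
  case=> al [_ al0 _]; have /card_gt0P[p _] := P0.
  by have := in_set0 (al p); rewrite -al0 imset_f ?inE.
move=> m mP; rewrite leqNgt; apply/negP => lt_m.
have [] := mP m.-1 0; first by rewrite add0n leqSpred.
have le_m k : k \in iota 0 m -> k <= m.-1.
  by rewrite mem_iota add0n; case: (m).
have [|X cX XP] := chain_copy (P := P) (iota_uniq 0 m) le_m.
  by rewrite size_iota ltnW.
exists X => //; apply/subsetP=> A /XP[].
rewrite mem_iota add0n => /andP[_ Am] _.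
rewrite /levels add0n big_mkord; apply/bigcupP.
by exists (Ordinal Am); rewrite ?inE.
Qed.

Lemma RR_min (dP dQ : Order.disp_t) (P : finPOrderType dP)
    (Q : finPOrderType dQ) :
  is_min (rainbow_ramsey P Q) (RR P Q).
Proof.
apply: nat_minP; set a := #|P| * #|P|; set b := #|Q| * #|Q|.
exists (a * b) => c; set n := a * b.
pose f k : nat := c [set i : 'I_n | i < k]%SET.
pose s := iota 0 n.+1.
have ins k : k \in s -> k <= n by rewrite mem_iota.
pose C := undup (map f s).
have [bC|Cb] := leqP b (size C).
  right.
  pose g x := nth 0 s (index x (map f s)).
  have gP x : x \in C -> g x \in s /\ f (g x) = x.
    rewrite mem_undup => xC.
    have lt : index x (map f s) < size s by rewrite -(size_map f) index_mem.
    by rewrite mem_nth // -(nth_map 0 0) // nth_index.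
  have [||//|X cX XP] := @chain_copy _ Q n (map g C).
  - rewrite map_inj_in_uniq ?undup_uniq // => x y /gP[_ xE] /gP[_ yE] gxy.
    by rewrite -xE -yE gxy.
  - by move=> _ /mapP[x /gP[/ins xn _] ->].
  - by rewrite size_map.
  exists X => // A A' /XP[/mapP[x xC xE] AE] /XP[/mapP[y yC yE] A'E].
  rewrite AE A'E xE yE -/(f _) -/(f _) (gP _ xC).2 (gP _ yC).2.
  by move=> ->.
left.
have [x [_ ax]] : exists x, x \in C /\ a <= count_mem x (map f s).
  apply: contrapT => nx.
  have lt x : x \in C -> count_mem x (map f s) <= a.
    by move=> xC; rewrite leqNgt; apply/negP => h; apply: nx; exists x; rewrite ltnW.
  have : size (map f s) <= a * b.
    have -> : size (map f s) = \sum_(x <- C) count_mem x (map f s).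
      rewrite -sum1_size -big_undup_iterop_count /=.
      by apply: eq_bigr => x _; rewrite Monoid.iteropE iter_addn_0 mul1n.
    apply: (@leq_trans (\sum_(x <- C) a)).
      by rewrite big_seq [leqRHS]big_seq; apply: leq_sum => x /lt.
    by rewrite big_const_seq count_predT iter_addn_0 leq_mul2l (ltnW Cb) orbT.
  by rewrite size_map size_iota ltnn.
have [||//|X cX XP] := @chain_copy _ P n [seq k <- s | f k == x].
- by rewrite filter_uniq // iota_uniq.
- by move=> k; rewrite mem_filter => /andP[_ /ins].
- by rewrite size_filter -(count_map f (pred1 x)).
exists X => // A A' /XP[+ AE] /XP[+ A'E].
rewrite !mem_filter => /andP[/eqP fA _] /andP[/eqP fA' _].
by rewrite AE A'E -/(f _) -/(f _) fA fA'.
Qed.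

(* Main.v *)
(** Colouring a set A by |A| %/ e(P) puts at most e(P) consecutive levels in
    each class, which gives the lower bound.

    For the upper bound, suppose that no class contains P. Let a chain climb
    at random from the empty set to [n]. Conditionally on the first set A of a
    given colour that it meets, the expected number of its sets of that colour
    is the Lubell mass of the class in the interval [A, [n]], again a Boolean
    lattice, hence at most e(P). So the number of sets of the chain, n + 1, is
    at most e(P) times the expected number of its colours, and some chain has
    at least (n + 1) / e(P) > |Q| - 1 colours: it contains a rainbow chain on
    |Q| sets, whence a rainbow weak copy of Q. The expectation is derandomised
    by choosing, one element at a time, a step which is at least as good as
    the average. If e(P) = 0, the bound applied to the empty set in B_1 forces
    |P| = 1, and then everything is trivial. *)
From mathcomp Require Import boolp.
From mathcomp Require Import all_boot all_order all_algebra.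
Require Import Defs.

Set Implicit Arguments.
Unset Strict Implicit.
Unset Printing Implicit Defensive.

Import Order.TTheory GRing.Theory Num.Theory.
Import Order.DefaultSetSubsetOrder.

(** * Injectivity along a list, and pulling back free families *)

Lemma uniq_map_inj_in (T1 T2 : eqType) (f : T1 -> T2) (s : seq T1) :
  uniq (map f s) -> {in s &, injective f}.
Proof.
move=> s_uniq x y xs ys fxy; rewrite -(nth_index x xs) -(nth_index x ys).
congr nth; apply/eqP.
rewrite -(nth_uniq (f x) _ _ s_uniq) ?size_map ?index_mem //.
by rewrite !(nth_map x) ?index_mem // !nth_index // fxy.
Qed.

Lemma free_preim (dP dR dR' : Order.disp_t) (P : finPOrderType dP)
    (R : finPOrderType dR) (R' : finPOrderType dR') (f : R -> R')
    (F : {set R'}) :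
  injective f -> {homo f : x y / (x <= y)%O} ->
  free P F -> free P (f @^-1: F)%SET.
Proof.
move=> f_inj f_homo F_free [X /subsetP XF [a [a_inj aX a_homo]]].
apply: F_free; exists (f @: X)%SET.
  by apply/subsetP => _ /imsetP[x /XF + ->]; rewrite inE.
exists (f \o a); split=> [||p q /a_homo/f_homo //]; first exact: inj_comp.
by rewrite imset_comp aX.
Qed.

(** * Embedding a poset in a chain with as many elements *)

Section LinearExtension.

Variables (d : Order.disp_t) (Q : finPOrderType d).

(** The values of [key] have gaps; [rank] closes them up, so a chain of only #|Q| elements
    suffices. *)
Definition rank (q : Q) : nat := #|[set r : Q | key r < key q]%SET|.

Lemma rank_bound q : rank q < #|Q|.
Proof.
rewrite -cardsT; apply/proper_card/properP; split; first exact: subsetT.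
by exists q; rewrite !inE ?ltnn.
Qed.

Lemma rank_homo q r : (q <= r)%O -> rank q <= rank r.
Proof.
move=> /key_homo qr; apply/subset_leq_card/subsetP => x.
by rewrite !inE => /leq_trans; apply.
Qed.

Lemma rank_lt q r : key q < key r -> rank q < rank r.
Proof.
move=> qr; apply/proper_card/properP; split.
  by apply/subsetP => x; rewrite !inE => /ltn_trans; apply.
by exists q; rewrite !inE ?ltnn.
Qed.

Lemma rank_inj : injective rank.
Proof.
move=> q r qr; apply: key_inj.
by case: (ltngtP (key q) (key r)) => // /rank_lt; rewrite qr ltnn.
Qed.

Lemma chain_weak_copy (dR : Order.disp_t) (R : finPOrderType dR) (s : seq R) :
  uniq s -> sorted <=%O s -> #|Q| <= size s ->
  exists2 X : {set R}, weak_copy Q X & {subset X <= s}.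
Proof.
move=> s_uniq s_sorted Qs; have rs q := leq_trans (rank_bound q) Qs.
have [/eqP Q0|/card_gt0P[q0 _]] := posnP #|Q|.
  have noQ (q : Q) : False by move: Q0; rewrite (cardD1 q).
  exists set0; last by move=> x; rewrite inE.
  exists (fun q => False_rect R (noQ q)).
  split=> [q||q]; first by case: (noQ q).
    by apply/setP=> x; rewrite inE; apply/imsetP => -[q]; case: (noQ q).
  by case: (noQ q).
have x0 : R by case: s {s_uniq s_sorted} Qs rs => [_ /(_ q0) //|].
pose a q := nth x0 s (rank q).
exists (a @: [set: Q])%SET; last by move=> _ /imsetP[q _ ->]; apply: mem_nth.
exists a; split=> // [q r /eqP|q r qr].
  by rewrite nth_uniq // => /eqP/rank_inj.
by apply: (sorted_leq_nth le_trans le_refl); rewrite ?inE ?rank_homo.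
Qed.

End LinearExtension.

Lemma mem_levels (n i m : nat) (A : B n) :
  i <= #|A| -> #|A| < i + m -> A \in levels n i m.
Proof.
move=> iA Am; rewrite /levels -{1}[i]add0n [i + m]addnC big_addn addnK.
have lt_m : #|A| - i < m by rewrite ltn_subLR.
rewrite big_mkord; apply/bigcupP; exists (Ordinal lt_m) => //.
by rewrite ?inE /= ?subnK.
Qed.

(** * Lower bound: colouring by blocks of [e P] levels *)

Section LowerBound.

Variables (dP dQ : Order.disp_t) (P : finPOrderType dP) (Q : finPOrderType dQ).

Lemma le_rainbow_ramsey (n : nat) :
  0 < #|P| -> rainbow_ramsey P Q n -> e P * (#|Q| - 1) <= n.
Proof.
move=> P0 nPQ; rewrite leqNgt; apply/negP => n_lt.
have e0 : 0 < e P by case: (e P) n_lt => //; rewrite mul0n.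
have [eP_free _] := e_max P0.
have card_le (A : B n) : #|A| <= n by rewrite -[leqRHS]card_ord max_card.
have [[X Pcopy Xmono]|[X [a [a_inj <- _]] Xrainbow]] :=
  nPQ (fun A : B n => #|A| %/ e P).
- have /card_gt0P[p0 _] := P0; have [a [_ aX _]] := Pcopy.
  have p0X : a p0 \in X by rewrite -aX imset_f ?inE.
  pose k := #|a p0| %/ e P * e P.
  have k_le : k <= n by apply: leq_trans (leq_trunc_div _ _) (card_le _).
  (* The top block of levels may be truncated in B n, but not in B (n + e P). *)
  pose f (A : B n) : B (n + e P) := (lshift (e P) @: A)%SET.
  have f_inj : injective f by apply: imset_inj; apply: lshift_inj.
  have f_homo : {homo f : x y / (x <= y)%O} by move=> x y; apply: imsetS.
  have le_k : k + e P <= (n + e P).+1 by rewrite leqW // leq_add2r.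
  apply: (free_preim f_inj f_homo (eP_free _ _ le_k)).
  exists X => //; apply/subsetP => A AX; rewrite !inE.
  have fA : #|f A| = #|A| by rewrite card_imset //; apply: lshift_inj.
  rewrite mem_levels // fA /k (Xmono _ _ p0X AX) ?leq_trunc_div //.
  by rewrite addnC -mulSn ltn_ceil.
(* Since n < e P * (#|Q| - 1), fewer than #|Q| colours occur, too few for a rainbow copy. *)
- have c_lt q : #|a q| %/ e P < #|Q| - 1.
    by rewrite ltn_divLR // mulnC; apply: leq_ltn_trans (card_le _) n_lt.
  have /leq_card : injective (fun q => Ordinal (c_lt q)).
    move=> q r /(congr1 val) /= qr; apply: a_inj.
    by apply: Xrainbow; rewrite ?imset_f ?inE.
  rewrite card_ord leqNgt; case/negP.
  by case: #|Q| n_lt => [|m]; rewrite ?muln0 // subn1.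
Qed.

End LowerBound.

(** * Random maximal chains of the interval from A to [n] *)

Section UpSum.

Local Open Scope ring_scope.

Variable n : nat.
Implicit Types (A X : {set 'I_n}) (F : {set {set 'I_n}}).

Lemma exists_mean_le (I : finType) (S : {set I}) (f : I -> rat) :
  (0 < #|S|)%N ->
  exists2 x, x \in S & (#|S|%:R)^-1 * (\sum_(x in S) f x) <= f x.
Proof.
move=> S0; have S0' : 0 < #|S|%:R :> rat by rewrite ltr0n.
apply: contrapT => no_x.
have lt_f x : x \in S -> f x < (#|S|%:R)^-1 * (\sum_(x in S) f x).
  by move=> xS; rewrite ltNge; apply/negP => ?; apply: no_x; exists x.
have /card_gt0P[x0 x0S] := S0.
have : \sum_(x in S) f x < \sum_(x in S) (#|S|%:R)^-1 * (\sum_(x in S) f x).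
  by apply: ltr_sum => //; apply/hasP; exists x0 => //; rewrite mem_index_enum.
by rewrite sumr_const -[ltRHS]mulr_natl mulVKf ?ltxx // gt_eqF.
Qed.

(* The probability that a uniformly random maximal chain of the interval
   [A, [n]] goes through X. *)
Definition up_weight A X : rat := ('C(#|~: A|, #|X :\: A|)%:R)^-1.

(** The expected number of members of F on a random maximal chain of the interval. *)
Definition up_mass A F : rat := \sum_(X in F | A \subset X) up_weight A X.

(** Condition on the first step of the chain: it adds a uniform x outside A, and X stays reachable
    only if x lies in X. *)
Lemma up_weight_step A X : A \proper X ->
  up_weight A X =
    (#|~: A|%:R)^-1 * \sum_(x in X :\: A) up_weight (x |: A) X.
Proof.
move=> /properP[_ [x0 x0X x0A]].
have b0 : (0 < #|X :\: A|)%N by rewrite (cardD1 x0) !inE x0X x0A.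
have bm : (#|X :\: A| <= #|~: A|)%N.
  by apply/subset_leq_card/subsetP => x; rewrite !inE => /andP[].
rewrite (eq_bigr (fun=> ('C(#|~: A|.-1, #|X :\: A|.-1)%:R)^-1)); last first.
  move=> x xXA; have := xXA; rewrite inE => /andP[xA xX].
  rewrite /up_weight (cardsD1 x (~: A)) inE xA (cardsD1 x (X :\: A)) xXA.
  by rewrite !add1n /= setDDl [A :|: _]setUC [~: A :\ x]setDE setCU setIC.
rewrite sumr_const /up_weight -[X in _ * X]mulr_natr.
move: b0 bm; case: #|X :\: A| => // b _; case: #|~: A| => //= m bm.
have /(congr1 (fun k => k%:R : rat)) := mul_bin_diag m.+1 b.
rewrite !natrM => h.
have C0 : 'C(m.+1, b.+1)%:R != 0 :> rat by rewrite pnatr_eq0 -lt0n bin_gt0.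
have C1 : 'C(m, b)%:R != 0 :> rat by rewrite pnatr_eq0 -lt0n bin_gt0.
have m0 : m.+1%:R != 0 :> rat by rewrite pnatr_eq0.
apply: (mulfI C0); rewrite divff //; apply: (mulfI m0); rewrite mulr1.
by rewrite mulrCA mulVKf // mulrCA [_ * b.+1%:R]mulrC -h mulrCA mulVf // mulr1.
Qed.

Lemma subset_up1 A X (x : 'I_n) :
  (x |: A \subset X) = (x \in X) && (A \subset X).
Proof. by rewrite subUset sub1set. Qed.

Lemma up_mass_step A F : A \notin F ->
  up_mass A F = (#|~: A|%:R)^-1 * \sum_(x in ~: A) up_mass (x |: A) F.
Proof.
move=> AF; rewrite /up_mass (exchange_big_dep (mem F)) => [|x X _ /andP[] //].
rewrite mulr_sumr big_mkcondr; apply: eq_bigr => X XF.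
case: ifPn => [AX|AX]; last first.
  rewrite big1 ?mulr0 // => x /and3P[_ _].
  by rewrite subset_up1 (negPf AX) andbF.
rewrite up_weight_step ?properEneq ?AX ?andbT; last first.
  by apply: contraNneq AF => ->.
by congr (_ * _); apply: eq_bigl => x; rewrite subset_up1 XF AX !inE andbT.
Qed.

Lemma up_massD1 A F : A \in F -> up_mass A F = 1 + up_mass A (F :\ A).
Proof.
move=> AF; rewrite /up_mass (bigD1 A) ?AF ?subxx //=; congr (_ + _).
  by rewrite /up_weight setDv cards0 bin0 invr1.
by apply: eq_bigl => X; rewrite !inE andbC andbA.
Qed.

Lemma up_massID A F (p : pred {set 'I_n}) :
  up_mass A F =
    up_mass A [set X in F | p X]%SET + up_mass A [set X in F | ~~ p X]%SET.
Proof.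
by rewrite /up_mass (bigID p); congr (_ + _); apply: eq_bigl => X;
   rewrite !inE andbAC.
Qed.

(** Each of the n + 1 levels contributes 1, as every maximal chain meets it exactly once. *)
Lemma up_mass_set0T : up_mass set0 setT = n.+1%:R.
Proof.
rewrite /up_mass.
rewrite (partition_big (fun X => inord #|X| : 'I_n.+1) xpredT) //=.
transitivity (\sum_(k < n.+1) 1 : rat); last by rewrite sumr_const card_ord.
apply: eq_bigr => k _.
rewrite (eq_big (mem [set X : {set 'I_n} | #|X| == k]%SET)
  (fun=> ('C(n, k)%:R)^-1)); first 1 last.
- move=> X; rewrite !inE sub0set -val_eqE /= inordK //.
  by rewrite ltnS -[leqRHS]card_ord max_card.
- move=> X /andP[_ /eqP <-]; rewrite /up_weight setC0 setD0 cardsT card_ord.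
  by rewrite inordK // ltnS -[leqRHS]card_ord max_card.
rewrite sumr_const card_draws card_ord -[LHS]mulr_natr mulVf //.
by rewrite pnatr_eq0 -lt0n bin_gt0 -ltnS.
Qed.

(* The interval [A, [n]] is a Boolean lattice on the complement of A. *)
Definition up_embed A (T : {set 'I_#|~: A|}) : {set 'I_n} :=
  A :|: (@enum_val _ (mem (~: A)) @: T)%SET.

Definition up_trace A X : {set 'I_#|~: A|} :=
  (@enum_val _ (mem (~: A)) @^-1: X)%SET.

Lemma up_embedK A : cancel (@up_embed A) (@up_trace A).
Proof.
move=> T; apply/setP => i; rewrite !inE mem_imset; last exact: enum_val_inj.
by have := enum_valP i; rewrite inE => /negPf ->.
Qed.

Lemma up_traceK A X : A \subset X -> up_embed (up_trace A X) = X.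
Proof.
move=> /subsetP AX; apply/setP => x; rewrite !inE.
have [/AX -> //|xA /=] := boolP (x \in A).
apply/imsetP/idP => [[i + ->]|xX]; first by rewrite inE.
have xCA : x \in ~: A by rewrite inE.
by exists (enum_rank_in xCA x); rewrite ?inE enum_rankK_in.
Qed.

Lemma up_mass_lubell A F :
  up_mass A F = lubell_mass (@up_embed A @^-1: F)%SET.
Proof.
rewrite /up_mass /lubell_mass.
rewrite (reindex_onto (@up_embed A) (@up_trace A)) /=.
  apply: eq_big => [T|T _].
    by rewrite up_embedK eqxx andbT inE subsetUl andbT.
  rewrite /up_weight /up_embed setDUl setDv set0U.
  rewrite (setDidPl _); first by rewrite card_imset //; apply: enum_val_inj.
  rewrite disjoint_sym disjoints_subset; apply/subsetP => x xA.
  rewrite inE; apply/imsetP => -[i _ xi].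
  by have := enum_valP i; rewrite inE -xi xA.
by move=> X /andP[_ /up_traceK].
Qed.

Lemma up_mass_le (d : Order.disp_t) (P : finPOrderType d) A F :
  uniformly_Lubell_bounded P -> (0 < e P)%N -> free P F ->
  up_mass A F <= (e P)%:R.
Proof.
(* If A is everything, the interval is B_0, where boundedness says nothing; the mass is then at most
   1. *)
move=> P_bounded eP0 F_free; have [A0|A0] := posnP #|~: A|.
  have up_mass0 (G : {set {set 'I_n}}) : A \notin G -> up_mass A G = 0.
    by move=> AG; rewrite up_mass_step // A0 invr0 mul0r.
  have [AF|/up_mass0 -> //] := boolP (A \in F).
  by rewrite up_massD1 // up_mass0 ?addr0 ?ler1n // !inE eqxx.
apply: le_trans (P_bounded _ A0).
rewrite up_mass_lubell; apply: le_bigmax_cond; apply/asboolP.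
apply: free_preim F_free; first exact: can_inj (@up_embedK A).
by move=> S T ST; apply/setUS/imsetS.
Qed.

End UpSum.

(** * Upper bound: a chain with many colours *)

Section UpperBound.

Local Open Scope ring_scope.

Variables (d : Order.disp_t) (P : finPOrderType d).
Hypotheses (P_bounded : uniformly_Lubell_bounded P) (eP0 : (0 < e P)%N).

(* S collects the colours that the chain has already used below A. *)
Lemma exists_rainbow_chain (n : nat) (c : {set 'I_n} -> nat) :
  (forall k, free P [set X | c X == k]%SET) ->
  forall (A : {set 'I_n}) (S : seq nat),
  exists s : seq {set 'I_n},
    [/\ sorted <=%O s, all (fun X : {set 'I_n} => A \subset X) s,
        uniq (map c s), all (fun X => c X \notin S) s &
        up_mass A [set X | c X \notin S]%SET <= (e P * size s)%:R].
Proof.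
move=> c_free A.
have [m] := ubnP #|~: A|; elim: m A => // m IH A /ltnSE Am S.
(* When the colour of A is already used, A counts for nothing and the chain moves to a best x |: A.
   At the top, 0^-1 = 0 makes the mass vanish. *)
have rest (S' : seq nat) : c A \in S' -> exists s : seq {set 'I_n},
    [/\ sorted <=%O s, all (fun X : {set 'I_n} => A \subset X) s,
        uniq (map c s), all (fun X => c X \notin S') s &
        up_mass A [set X | c X \notin S']%SET <= (e P * size s)%:R].
  move=> cA; rewrite up_mass_step ?inE ?cA //.
  have [A0|A0] := posnP #|~: A|.
    by exists [::]; split=> //; rewrite A0 invr0 mul0r ler0n.
  have [x xA le_x] := exists_mean_le
    (fun x => up_mass (x |: A) [set X | c X \notin S']%SET) A0.
  have [|s [s1 s2 s3 s4 s5]] := IH (x |: A) _ S'.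
    by apply: leq_trans Am; rewrite setCU setIC -setDE (cardsD1 x (~: A)) xA.
  exists s; split=> //; last exact: le_trans s5.
  by apply: sub_all s2 => X; rewrite subset_up1 => /andP[].
have [/rest //|cA] := boolP (c A \in S).
(* A new colour: keep A in the chain, mark its colour as used and continue from the same A. The
   discarded colour class costs at most [e P], paid for by the extra element A. *)
have [|s [s1 s2 s3 s4 s5]] := rest (c A :: S); first by rewrite inE eqxx.
exists (A :: s); split=> /=.
- by rewrite (path_sortedE le_trans) s1 andbT.
- by rewrite subxx.
- rewrite s3 andbT; apply/mapP => -[X /(allP s4) + cX].
  by rewrite inE -cX eqxx.
- by rewrite cA; apply: sub_all s4 => X; rewrite inE negb_or => /andP[].
- rewrite (up_massID _ _ (fun X => c X == c A)) mulnS natrD; apply: lerD.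
    rewrite (_ : [set X in _ | _]%SET = [set X | c X == c A]%SET).
      exact: up_mass_le.
    by apply/setP => X; rewrite !inE; case: eqP => [->|]; rewrite ?cA ?andbF.
  rewrite (_ : [set X in _ | _]%SET = [set X | c X \notin c A :: S]%SET) //.
  by apply/setP => X; rewrite !inE negb_or andbC.
Qed.

Lemma rainbow_ramsey_upper (dQ : Order.disp_t) (Q : finPOrderType dQ) :
  (0 < #|Q|)%N -> rainbow_ramsey P Q (e P * (#|Q| - 1)).
Proof.
move=> Q0 c; set n := (e P * _)%N in c *.
apply: contrapT => /not_orP[no_mono no_rainbow].
have c_free k : free P [set X | c X == k]%SET.
  move=> [X /subsetP Xk XP]; apply: no_mono; exists X => // A A' /Xk + /Xk.
  by rewrite !inE => /eqP -> /eqP ->.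
have [s [s_sorted _ s_uniq _]] := exists_rainbow_chain c_free set0 [::].
rewrite (_ : [set X | _]%SET = setT); last by apply/setP => X; rewrite !inE.
(* The +1 in n + 1 <= e P * size s makes the inequality strict, hence #|Q| - 1 < size s. *)
rewrite up_mass_set0T ler_nat ltn_mul2l eP0 /= => s_lt.
have Qs : (#|Q| <= size s)%N by rewrite -(subnK Q0) addn1.
have [X XQ /= Xs] := chain_weak_copy (map_uniq s_uniq) s_sorted Qs.
apply: no_rainbow; exists X => // A A' /Xs As /Xs A's.
exact: uniq_map_inj_in s_uniq _ _ As A's.
Qed.

End UpperBound.

(** * The case [e P] = 0, and the conclusion *)

Lemma card_le1_of_e0 (d : Order.disp_t) (P : finPOrderType d) :
  uniformly_Lubell_bounded P -> e P = 0 -> #|P| <= 1.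
Proof.
move=> P_bounded eP0; rewrite leqNgt; apply/negP => P1.
have P_free : free P [set set0 : B 1]%SET.
  move=> [X /subset_leq_card + [a [a_inj aX _]]].
  by rewrite -aX card_imset // cardsT cards1 leqNgt P1.
have : (lubell_mass [set set0 : B 1]%SET <= (e P)%:R)%R.
  apply: le_trans (P_bounded 1 isT).
  by apply: le_bigmax_cond; apply/asboolP.
by rewrite eP0 /lubell_mass big_set1 cards0 bin0 invr1 ler10.
Qed.

Lemma rainbow_ramsey_card1 (dP dQ : Order.disp_t) (P : finPOrderType dP)
    (Q : finPOrderType dQ) (n : nat) : #|P| <= 1 -> rainbow_ramsey P Q n.
Proof.
move=> P1 c; left; exists ((fun _ : P => set0 : B n) @: [set: P])%SET.
  exists (fun=> set0); split=> // p q _.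
  by apply: (fintype_le1P P1).
by move=> _ _ /imsetP[p _ ->] /imsetP[q _ ->].
Qed.

Theorem corollary1p5 (dP : Order.disp_t) (P : finPOrderType dP)
    (P_nonempty : 0 < #|P|) (P_bounded : uniformly_Lubell_bounded P)
    (dQ : Order.disp_t) (Q : finPOrderType dQ) (Q_nonempty : 0 < #|Q|) :
  RR P Q = e P * (#|Q| - 1).
Proof.
have [RR_ramsey RR_le] := RR_min P Q.
apply/eqP; rewrite eqn_leq le_rainbow_ramsey // andbT; apply: RR_le.
have [eP0|eP0] := posnP (e P); last exact: rainbow_ramsey_upper.
exact/rainbow_ramsey_card1/card_le1_of_e0.
Qed.
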